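(* A hereditary graph class is subexponential if and only if it is a function of $\mathcal{L}$.
   Context: All graphs are finite and simple; a class of graphs is a set of graphs closed under isomorphism; it is hereditary if closed under taking induced subgraphs. For a class $\mathcal{X}$, $\mathcal{X}^n$ is the set of graphs in $\mathcal{X}$ with vertex set $[n]$; $\mathcal{X}$ is subexponential if $|\mathcal{X}^n|=2^{o(n)}$. $\mathcal{L}$ is the class consisting of all complete graphs and all graphs with exactly two connected components, one of which is a single isolated vertex and the other a complete graph. For a graph $G$ and distinct vertices $u,w$, $G(u,w)=1$ if they are adjacent and $0$ otherwise. If $G,H_1,\dots,H_k$ are graphs on the same vertex set $V$, $G$ is a (boolean) function of $H_1,\dots,H_k$ if there is a boolean function $f:\{0,1\}^k\to\{0,1\}$ with $G(a,b)=f(H_1(a,b),\dots,H_k(a,b))$ for all distinct $a,b\in V$. A class $\mathcal{Y}$ is a $k$-function of $\mathcal{X}$ if every $G\in\mathcal{Y}$ is a function of at most $k$ graphs from $\mathcal{X}$ (on the vertex set of $G$); $\mathcal{Y}$ is a function of $\mathcal{X}$ if it is a $k$-function for some $k\in\mathbb{N}$. *)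

(* Defs.v *)
From HB Require Import structures.
From mathcomp Require Import all_boot all_order all_algebra.
From mathcomp Require Import boolp classical_sets reals topology normedtype landau exp.

Set Implicit Arguments.
Unset Strict Implicit.
Unset Printing Implicit Defensive.

Import Order.TTheory GRing.Theory Num.Theory.
Import numFieldNormedType.Exports.

(* Simple graphs with vertex set [V]. The adjacency relation is stored as a
   finite function, so that [sgraph V] is itself a finite type and its elements
   can be counted. *)
Definition sgraph_axiom (V : finType) (e : {ffun V * V -> bool}) : bool :=
  [forall u, ~~ e (u, u)] && [forall u, forall w, e (u, w) == e (w, u)].

Record sgraph (V : finType) : Type := SGraph {
  sgraph_edges : {ffun V * V -> bool};
  sgraph_edgesP : sgraph_axiom sgraph_edges
}.

HB.instance Definition _ (V : finType) :=
  [isSub for @sgraph_edges V].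
HB.instance Definition _ (V : finType) := [Finite of sgraph V by <:].

Definition adj (V : finType) (G : sgraph V) : rel V :=
  fun u w => sgraph_edges G (u, w).

Lemma induced_axiom (V : finType) (G : sgraph V) (S : {set V}) :
  sgraph_axiom [ffun p : {x : V | x \in S} * {x : V | x \in S} =>
    adj G (val p.1) (val p.2)].
Proof.
have /andP[/forallP irr /forallP sym] := sgraph_edgesP G.
apply/andP; split; apply/forallP=> u; first by rewrite ffunE; exact: irr.
by apply/forallP=> w; rewrite !ffunE; exact: (forallP (sym _)).
Qed.

Definition induced (V : finType) (G : sgraph V) (S : {set V}) :
    sgraph {x : V | x \in S} :=
  SGraph (induced_axiom G S).

Definition graph_iso (V W : finType) (G : sgraph V) (H : sgraph W) : Prop :=
  exists2 f : V -> W,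
    bijective f & forall u w, adj G u w = adj H (f u) (f w).

Definition graph_family : Type := forall V : finType, sgraph V -> Prop.

Definition graph_class (X : graph_family) : Prop :=
  forall (V W : finType) (G : sgraph V) (H : sgraph W),
    graph_iso G H -> X V G -> X W H.

Definition hereditary (X : graph_family) : Prop :=
  forall (V : finType) (G : sgraph V) (S : {set V}),
    X V G -> X {x : V | x \in S} (induced G S).

Definition num_labelled (X : graph_family) (n : nat) : nat :=
  #|[pred G : sgraph 'I_n | `[< X 'I_n G >]]|.

(* [2 ^ o(n)] is read as an upper bound: the number of labelled graphs may be
   [0], for instance for all large [n] when the class is finite. *)
Definition subexponential (R : realType) (X : graph_family) : Prop :=
  exists2 g : nat -> R,
    (g =o_\oo (fun n : nat => n%:R%R : R))%classic &
    forall n : nat, ((num_labelled X n)%:R <= 2 `^ g n)%R.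

Definition complete_on (V : finType) (G : sgraph V) (S : {set V}) : Prop :=
  {in S &, forall u w, u != w -> adj G u w}.

Definition is_complete (V : finType) (G : sgraph V) : Prop :=
  complete_on G [set: V].

Definition component (V : finType) (G : sgraph V) (x : V) : {set V} :=
  [set y | connect (adj G) x y]%SET.

Definition components (V : finType) (G : sgraph V) : {set {set V}} :=
  [set component G x | x : V]%SET.

Definition class_L : graph_family := fun V G =>
  is_complete G \/
  exists C D : {set V},
    [/\ C != D, components G = [set C; D]%SET, #|C| = 1 & complete_on G D].

Definition graph_function (V : finType) (G : sgraph V) (k : nat)
    (H : 'I_k -> sgraph V) : Prop :=
  exists f : {ffun 'I_k -> bool} -> bool,
    forall a b : V, a != b -> adj G a b = f [ffun i => adj (H i) a b].

Definition k_function_of (k : nat) (Y X : graph_family) : Prop :=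
  forall (V : finType) (G : sgraph V), Y V G ->
    exists2 j : nat, j <= k &
      exists2 H : 'I_j -> sgraph V,
        forall i, X V (H i) & graph_function G H.

Definition function_of (Y X : graph_family) : Prop :=
  exists k : nat, k_function_of k Y X.

(* Main.v *)
Require Import Defs.
From mathcomp Require Import all_boot all_order all_algebra.
From mathcomp Require Import boolp reals topology normedtype landau exp.
From mathcomp Require Import zify lra.

(** A graph is a function of [k] members of L iff all but at most [k] of its
    vertices are pairwise twins, so such a class has at most
    [(n + 1) ^ k * 2 ^ (2 ^ k)] labelled graphs on [n] vertices.

    Conversely, two configurations force exponentially many labelled graphs in a
    hereditary class. A vertex with [m] neighbours and [m] non-neighbours gives
    [2 ^ m] graphs on [m + 1] vertices, since any [m]-set of labels splits
    arbitrarily between the two sides. And [s] disjoint triples [(x; y, z)], where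
    [x] is adjacent to exactly one of [y] and [z], give [2 ^ s] graphs on [2 s]
    vertices, by keeping either [y] or [z] in each triple. If both are bounded,
    delete a maximal family of disjoint triples: what remains is a clique or an
    independent set, and each deleted vertex is constant on it up to fewer than
    [m] exceptions. Deleting the exceptions too leaves a set of twins. *)

Set Implicit Arguments.
Unset Strict Implicit.
Unset Printing Implicit Defensive.

Import Order.TTheory GRing.Theory Num.Theory.
Import numFieldNormedType.Exports.

Local Open Scope nat_scope.

(** * Pullbacks of graphs and closure under injective relabelling *)

Lemma adj_irrefl (V : finType) (G : sgraph V) : irreflexive (adj G).
Proof.
move=> u; have /andP[/forallP irr _] := sgraph_edgesP G.
exact/negbTE/irr.
Qed.

Lemma adj_sym (V : finType) (G : sgraph V) : symmetric (adj G).
Proof.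
move=> u w; have /andP[_ /forallP sym] := sgraph_edgesP G.
exact/eqP/(forallP (sym u)).
Qed.

Lemma sgraph_ext (V : finType) (G H : sgraph V) :
  (forall u w, u != w -> adj G u w = adj H u w) -> G = H.
Proof.
move=> eqGH; apply: val_inj; apply/ffunP=> -[u w].
have [->|neq_uw] := eqVneq u w; last exact: eqGH.
by rewrite [LHS]adj_irrefl [RHS]adj_irrefl.
Qed.

Lemma pullback_axiom (V W : finType) (f : W -> V) (G : sgraph V) :
  sgraph_axiom [ffun p : W * W => adj G (f p.1) (f p.2)].
Proof.
apply/andP; split; apply/forallP=> u; first by rewrite ffunE adj_irrefl.
by apply/forallP=> w; rewrite !ffunE adj_sym.
Qed.

Definition pullback (V W : finType) (f : W -> V) (G : sgraph V) : sgraph W :=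
  SGraph (pullback_axiom f G).

Lemma adj_pullback (V W : finType) (f : W -> V) (G : sgraph V) u w :
  adj (pullback f G) u w = adj G (f u) (f w).
Proof. by rewrite /adj ffunE. Qed.

(** For injective [f], the pullback is isomorphic to the subgraph induced on the image of [f],
    through [iinv]. *)
Lemma pullback_closed (X : graph_family) (V W : finType) (f : W -> V)
    (G : sgraph V) :
  graph_class X -> hereditary X -> injective f -> X V G ->
  X W (pullback f G).
Proof.
move=> Xc Xh f_inj XG.
pose S := [set x in codom f].
have SP (x : {x : V | x \in S}) : val x \in codom f.
  by have := valP x; rewrite inE.
have fS w : f w \in S by rewrite inE codom_f.
apply: Xc (Xh V G S XG); exists (fun x => iinv (SP x)).
  exists (fun w => exist _ (f w) (fS w)) => [x|w].
    by apply: val_inj; rewrite /= f_iinv.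
  by apply: f_inj; rewrite f_iinv.
by move=> u w; rewrite adj_pullback !f_iinv /adj ffunE.
Qed.

(** * Lower bounds on the number of labelled graphs *)

(** Each of the [2 ^ #|I|] bit vectors [A] selects a labelled induced subgraph of [G], and
    [phi_dist] makes these graphs distinct. *)
Lemma num_labelled_ge (X : graph_family) (I V W : finType) (G : sgraph V)
    (phi : {ffun I -> bool} -> W -> V) :
  graph_class X -> hereditary X -> X V G -> (forall A, injective (phi A)) ->
  (forall A B, (forall u w, adj G (phi A u) (phi A w) =
                            adj G (phi B u) (phi B w)) -> A = B) ->
  2 ^ #|I| <= num_labelled X #|W|.
Proof.
move=> Xc Xh XG phi_inj phi_dist.
pose h A : sgraph 'I_#|W| := pullback (phi A \o enum_val) G.
have h_inj : injective h.
  move=> A B eqAB; apply: phi_dist => u w.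
  have := congr1 (fun H => adj H (enum_rank u) (enum_rank w)) eqAB.
  by rewrite !adj_pullback /= !enum_rankK.
rewrite -card_bool -card_ffun -(card_image h_inj).
apply: subset_leq_card; apply/subsetP=> _ /imageP[A _ ->].
rewrite inE; apply/asboolP; apply: pullback_closed => //.
by apply: inj_comp => //; exact: enum_val_inj.
Qed.

(** The label [None] goes to the centre [z], and [Some i] to the [i]-th chosen vertex of [P] or of
    [Q] according to [A i]; the adjacency of the two labels returns [A i]. *)
Lemma num_labelled_star (X : graph_family) (V : finType) (G : sgraph V)
    (P Q : {set V}) (z : V) (m : nat) :
  graph_class X -> hereditary X -> X V G -> z \notin P ->
  z \notin Q -> m <= #|P| -> m <= #|Q| ->
  {in P, forall y, adj G z y} -> {in Q, forall y, ~~ adj G z y} ->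
  2 ^ m <= num_labelled X m.+1.
Proof.
move=> Xc Xh XG zP zQ mP mQ adjP adjQ.
pose p (i : 'I_m) := enum_val (widen_ord mP i).
pose q (i : 'I_m) := enum_val (widen_ord mQ i).
have pP i : p i \in P by exact: enum_valP.
have qQ i : q i \in Q by exact: enum_valP.
have p_inj : injective p by move=> i j /enum_val_inj [] /val_inj.
have q_inj : injective q by move=> i j /enum_val_inj [] /val_inj.
have pq i j : p i <> q j.
  by move=> e; have := adjQ _ (qQ j); rewrite -e adjP.
pose phi (A : {ffun 'I_m -> bool}) (o : option 'I_m) :=
  if o is Some i then if A i then p i else q i else z.
have := @num_labelled_ge X _ V _ G phi Xc Xh XG.
rewrite card_option card_ord; apply.
  move=> A [i|] [j|] //=.
  - case: (A i); case: (A j).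
    + by move/p_inj->.
    + by move/pq.
    + by move/esym/pq.
    + by move/q_inj->.
  - by case: (A i) => e; move: zP zQ; rewrite -e ?pP ?qQ.
  - by case: (A j) => e; move: zP zQ; rewrite e ?pP ?qQ.
move=> A B eqAB; apply/ffunP=> i.
have adjA C : adj G (phi C None) (phi C (Some i)) = C i.
  rewrite /=; case: (C i); first exact: adjP.
  exact/negbTE/adjQ.
by rewrite -adjA eqAB adjA.
Qed.

(* [h (i, None)] distinguishes [h (i, Some true)] from [h (i, Some false)]. *)
Definition split_triples (V : finType) (G : sgraph V) (I : finType)
    (h : I * option bool -> V) : Prop :=
  injective h /\
  forall i, adj G (h (i, None)) (h (i, Some true)) !=
            adj G (h (i, None)) (h (i, Some false)).

(** The label [(i, false)] goes to the distinguishing vertex of triple [i] and [(i, true)] to the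
    one picked by [A i], so their adjacency determines [A i]. *)
Lemma num_labelled_triples (X : graph_family) (V : finType) (G : sgraph V)
    (I : finType) (h : I * option bool -> V) :
  graph_class X -> hereditary X -> X V G -> split_triples G h ->
  2 ^ #|I| <= num_labelled X (#|I| * 2).
Proof.
move=> Xc Xh XG [h_inj h_split].
pose phi (A : {ffun I -> bool}) (w : I * bool) :=
  h (w.1, if w.2 then Some (A w.1) else None).
have := @num_labelled_ge X _ V _ G phi Xc Xh XG.
rewrite card_prod card_bool; apply.
  by move=> A [i []] [j []] /h_inj //= [->].
move=> A B eqAB; apply/ffunP=> i.
have := eqAB (i, false) (i, true); rewrite /phi /= => e.
have := h_split i.
by case: (A i) (B i) e => [] [] // ->; rewrite eqxx.
Qed.

(** * Twin covers of bounded size *)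

(** Greedy choice: either the vertices outside the triples found so far contain a further triple,
    indexed by [None], or those triples form [T]. *)
Lemma split_triples_or_cover (V : finType) (G : sgraph V) (s : nat) :
  (exists (I : finType) (h : I * option bool -> V),
     #|I| = s /\ split_triples G h) \/
  exists2 T : {set V}, #|T| <= s * 3 &
    forall x y z, x \notin T -> y \notin T -> z \notin T ->
      x != y -> x != z -> adj G x y = adj G x z.
Proof.
elim: s => [|s [[I [h [cardI [h_inj h_split]]]]|[T cardT T_hom]]].
- left; exists void, (fun p => of_void V p.1).
  by split; [rewrite card_void | split=> [[]|[]]].
- pose T := [set x in codom h].
  have [[x [y [z [/and3P[xT yT zT] neq_xy neq_xz adj_neq]]]]|hom] := pselect
    (exists x y z, [/\ [&& x \notin T, y \notin T & z \notin T],
       x != y, x != z & adj G x y != adj G x z]).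
  + left; pose t c := if c is Some b then if b then y else z else x.
    have t_inj : injective t.
      have yz : y != z by apply: contraNneq adj_neq => ->.
      move=> [[]|] [[]|] //= e; move: neq_xy neq_xz yz;
        by rewrite e ?eqxx.
    have tT c : t c \notin codom h.
      by move: xT yT zT; rewrite !inE; case: c => [[]|].
    exists (option I),
      (fun p => if p.1 is Some i then h (i, p.2) else t p.2).
    split; first by rewrite card_option cardI.
    split=> [[[i|] c] [[j|] d] /=|[i|]] //.
    * by move/h_inj=> [-> ->].
    * by move=> e; case/negP: (tT d); rewrite -e codom_f.
    * by move=> e; case/negP: (tT c); rewrite e codom_f.
    * by move/t_inj->.
    * exact: h_split.
  + right; exists T.
      rewrite cardsE card_codom // card_prod card_option card_bool cardI.
      by rewrite leq_mul2r leqnSn.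
    move=> x y z xT yT zT neq_xy neq_xz; apply/eqP/negP=> /negP adj_neq.
    by apply: hom; exists x, y, z; split=> //; apply/and3P.
- by right; exists T => //; apply: leq_trans cardT _; lia.
Qed.

(* The vertices outside [S] are pairwise twins. *)
Definition twin_cover (V : finType) (G : sgraph V) (S : {set V}) : Prop :=
  forall x y z, y \notin S -> z \notin S -> x != y -> x != z ->
    adj G x y = adj G x z.

Lemma exists_twin_cover (X : graph_family) (m s : nat) :
  graph_class X -> hereditary X ->
  num_labelled X m.+1 < 2 ^ m -> num_labelled X (s * 2) < 2 ^ s ->
  forall (V : finType) (G : sgraph V), X V G ->
  exists2 S : {set V}, #|S| <= s * 3 + s * 3 * m & twin_cover G S.
Proof.
move=> Xc Xh Xm Xs V G XG.
have [[I [h [cardI hP]]]|[T cardT T_hom]] := split_triples_or_cover G s.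
  have := num_labelled_triples Xc Xh XG hP.
  by rewrite cardI leqNgt Xs.
pose P t := [set y | adj G t y].
pose Q t := [set y | ~~ adj G t y & t != y].
(* The exceptions of [t]: its neighbours if there are fewer than [m], otherwise its non-neighbours,
   of which the star count allows at most [m]. *)
pose E t := if #|P t| < m then P t else Q t.
have cardE t : #|E t| <= m.
  rewrite /E; have [/ltnW//|mP] := ltnP #|P t| m.
  rewrite leqNgt; apply/negP=> /ltnW mQ.
  suff : 2 ^ m <= num_labelled X m.+1 by rewrite leqNgt Xm.
  apply: (@num_labelled_star X V G (P t) (Q t) t) => //.
  - by rewrite inE adj_irrefl.
  - by rewrite inE eqxx andbF.
  - by move=> y; rewrite inE.
  - by move=> y; rewrite inE => /andP[].
exists (T :|: \bigcup_(t in T) E t).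
  apply: leq_trans (leq_card_setU _ _) _; apply: leq_add => //.
  apply: leq_trans (_ : #|T| * m <= _); last by rewrite leq_mul2r cardT orbT.
  rewrite -sum_nat_const.
  elim/big_rec2: _ => [|t a B _ leBa]; first by rewrite cards0.
  by apply: leq_trans (leq_card_setU _ _) _; apply: leq_add.
move=> x y z; rewrite !inE !negb_or => /andP[yT yE] /andP[zT zE] xy xz.
(* For [x] in [T], both [y] and [z] avoid [E x] and so lie on the same side of [x]; otherwise all
   three vertices are outside [T]. *)
have [xT|/T_hom] := boolP (x \in T); last exact.
have yEx : y \notin E x by apply: contra yE => yE; apply/bigcupP; exists x.
have zEx : z \notin E x by apply: contra zE => zE; apply/bigcupP; exists x.
move: yEx zEx; rewrite /E; case: ifP => _; rewrite !inE.
  by move=> /negbTE-> /negbTE->.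
by rewrite xy xz !andbT !negbK => -> ->.
Qed.

(** * Members of [class_L] encoded by an optional isolated vertex *)

Lemma isolated_axiom (V : finType) (o : option V) :
  sgraph_axiom [ffun p : V * V =>
    [&& p.1 != p.2, o != Some p.1 & o != Some p.2]].
Proof.
apply/andP; split; apply/forallP=> u; first by rewrite ffunE eqxx.
by apply/forallP=> w; rewrite !ffunE /= [u == w]eq_sym [X in (_ && X) == _]andbC.
Qed.

(* [isolated None] is the complete graph. *)
Definition isolated (V : finType) (o : option V) : sgraph V :=
  SGraph (isolated_axiom o).

Lemma adj_isolated (V : finType) (o : option V) u w :
  adj (isolated o) u w = [&& u != w, o != Some u & o != Some w].
Proof. by rewrite /adj ffunE. Qed.

Lemma component_refl (V : finType) (G : sgraph V) x : x \in component G x.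
Proof. by rewrite inE connect0. Qed.

Lemma isolated_class_L (V : finType) (o : option V) : class_L (isolated o).
Proof.
case: o => [v|]; last by left=> u w _ _ uw; rewrite adj_isolated uw.
(* If [v] is the only vertex, there is a single component and the graph counts as complete. *)
have [[w wv]|no_w] := pselect (exists w, w != v); last first.
  left=> u w _ _ uw; case: no_w.
  have [eq_uv|uv] := eqVneq u v; last by exists u.
  by exists w; rewrite eq_sym -eq_uv.
have complD : complete_on (isolated (Some v)) [set~ v].
  move=> a b; rewrite !inE => av bv ab; rewrite adj_isolated ab /=.
  by rewrite !(inj_eq Some_inj) ![v == _]eq_sym av bv.
have compv : component (isolated (Some v)) v = [set v].
  apply/setP=> y; rewrite !inE; apply/idP/eqP=> [|->]; last exact: connect0.
  case/connectP=> -[|a p] /=; first by [].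
  by rewrite adj_isolated eqxx andbF.
have compD x : x != v -> component (isolated (Some v)) x = [set~ v].
  move=> xv; apply/setP=> y; rewrite !inE; apply/idP/idP=> [|yv].
    case/connectP=> p; elim/last_ind: p => [|p a _] /=; first by move=> _ ->.
    rewrite rcons_path last_rcons adj_isolated => /andP[_ /and3P[_ _ va]] ->.
    by apply: contraNneq va => ->.
  have [->|xy] := eqVneq x y; first exact: connect0.
  by apply: connect1; apply: complD; rewrite ?inE.
right; exists [set v], [set~ v]; split=> //; last by rewrite cards1.
  by apply/eqP=> /setP/(_ v); rewrite !inE eqxx.
apply/setP=> C; rewrite !inE; apply/imsetP/orP=> [[x _ ->]|[]/eqP->].
- have [->|xv] := eqVneq x v; first by left; rewrite compv.
  by right; rewrite compD.
- by exists v; rewrite ?compv.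
- by exists w; rewrite ?compD.
Qed.

(** The singleton component supplies the vertex [v] without neighbours; every other vertex lies in
    the complete part [D]. *)
Lemma class_L_isolated (V : finType) (G : sgraph V) :
  class_L G -> exists o, G = isolated o.
Proof.
case=> [Gc|[C [D [CD compsG /eqP/cards1P[v Cv] Dc]]]].
  exists None; apply: sgraph_ext => u w uw.
  by rewrite adj_isolated uw; apply: Gc; rewrite ?inE.
have compv : component G v = [set v].
  have : C \in components G by rewrite compsG !inE eqxx.
  case/imsetP=> x _ Cx; have := component_refl G x.
  by rewrite -Cx Cv inE => /eqP xv; rewrite -xv -Cx Cv xv.
have inD y : y != v -> y \in D.
  move=> yv; have : component G y \in components G by exact: imset_f.
  rewrite compsG !inE => /orP[]/eqP compy; have := component_refl G y.
    by rewrite compy Cv inE (negbTE yv).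
  by rewrite compy.
have adjv y : adj G v y = false.
  apply/negP=> vy; have : y \in component G v by rewrite inE connect1.
  by rewrite compv inE => /eqP yv; rewrite yv adj_irrefl in vy.
exists (Some v); apply: sgraph_ext => u w uw; rewrite adj_isolated uw /=.
rewrite !(inj_eq Some_inj) ![v == _]eq_sym.
have [->|uv] := eqVneq u v; first exact: adjv.
have [->|wv] := eqVneq w v; first by rewrite adj_sym adjv.
by apply: Dc => //; exact: inD.
Qed.

(** * Boolean functions of [class_L]: construction and counting *)

(** Take one graph per vertex of [S], isolating that vertex. The bits of a pair then record exactly
    its intersection with [S], and the twin property makes adjacency depend on this intersection
    alone. *)
Lemma twin_cover_function (V : finType) (G : sgraph V) (S : {set V}) :
  twin_cover G S ->
  exists2 H : 'I_#|S| -> sgraph V,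
    forall i, class_L (H i) & graph_function G H.
Proof.
move=> twS; exists (fun i => isolated (Some (enum_val i))) => [i|].
  exact: isolated_class_L.
pose pat a b := [ffun i : 'I_#|S| => adj (isolated (Some (enum_val i))) a b].
have pat_sym a b : pat a b = pat b a by apply/ffunP=> i; rewrite !ffunE adj_sym.
have patP a b x : a != b -> forall xS : x \in S,
    pat a b (enum_rank_in xS x) = (x != a) && (x != b).
  move=> ab xS; rewrite ffunE adj_isolated enum_rankK_in // ab.
  by rewrite !(inj_eq Some_inj).
have pat_mem a b c d x : a != b -> c != d -> pat a b = pat c d -> x \in S ->
    (x == a) || (x == b) -> (x == c) || (x == d).
  move=> ab cd e xS; apply: contraLR; rewrite !negb_or -(patP _ _ _ cd xS) -e.
  by rewrite patP.
(* Pairs sharing an endpoint [a]: if [b] or [d] lies in [S] the patterns force [b = d], otherwise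
   [b] and [d] are twins. *)
have same a b d : a != b -> a != d -> pat a b = pat a d -> adj G a b = adj G a d.
  move=> ab ad e.
  have [bS|bS] := boolP (b \in S).
    have := pat_mem _ _ _ _ b ab ad e bS.
    by rewrite eqxx orbT [b == a]eq_sym (negbTE ab) => /(_ isT)/eqP<-.
  have [dS|dS] := boolP (d \in S); last exact: twS.
  have := pat_mem _ _ _ _ d ad ab (esym e) dS.
  by rewrite eqxx orbT [d == a]eq_sym (negbTE ad) => /(_ isT)/eqP<-.
have sameS a b c d : a \in S -> a != b -> c != d -> pat a b = pat c d ->
    adj G a b = adj G c d.
  move=> aS ab cd e; have := pat_mem _ _ _ _ a ab cd e aS.
  rewrite eqxx => /(_ isT)/orP[]/eqP eq_a; move: cd e; rewrite -eq_a.
    by move=> ad e; exact: same.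
  by rewrite eq_sym [pat c a]pat_sym [adj G c a]adj_sym; exact: same.
have pat_adj a b c d : a != b -> c != d -> pat a b = pat c d ->
    adj G a b = adj G c d.
  move=> ab cd e.
  have [aS|aS] := boolP (a \in S); first exact: sameS.
  have [bS|bS] := boolP (b \in S).
    rewrite adj_sym; apply: sameS => //; first by rewrite eq_sym.
    by rewrite pat_sym.
  have [cS|cS] := boolP (c \in S); first exact/esym/sameS.
  have [dS|dS] := boolP (d \in S).
    rewrite [RHS]adj_sym; apply/esym/sameS=> //; first by rewrite eq_sym.
    by rewrite pat_sym.
  (* With no endpoint in [S], endpoints are exchanged one at a time, passing through the pair [a],
     [d] when these differ. *)
  have [eq_ad|ad] := eqVneq a d.
    by rewrite -eq_ad [RHS]adj_sym; apply: twS; rewrite // eq_ad eq_sym.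
  by rewrite (twS a b d) // adj_sym [RHS]adj_sym; apply: twS; rewrite // eq_sym.
(* Patterns realised by no pair receive the value [false]. *)
exists (fun p => `[< exists a b, [/\ a != b, pat a b = p & adj G a b] >]).
move=> a b ab; apply/idP/asboolP=> [adj_ab|[c [d [cd e]]]].
  by exists a, b.
by rewrite (pat_adj c d a b).
Qed.

(** Such a graph is encoded by [k] optional isolated vertices and a truth table on [k] bits. *)
Lemma num_labelled_function (X : graph_family) (k n : nat) :
  k_function_of k X class_L -> num_labelled X n <= n.+1 ^ k * 2 ^ (2 ^ k).
Proof.
move=> Xk.
pose code := ({ffun 'I_k -> option 'I_n} *
              {ffun {ffun 'I_k -> bool} -> bool})%type.
pose F (c : code) : {ffun 'I_n * 'I_n -> bool} := [ffun p =>
  (p.1 != p.2) && c.2 [ffun i => adj (isolated (c.1 i)) p.1 p.2]].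
have cardC : #|{: code}| = n.+1 ^ k * 2 ^ (2 ^ k).
  by rewrite card_prod !card_ffun card_option card_bool !card_ord.
rewrite -cardC /num_labelled -(card_image val_inj).
apply: leq_trans (leq_image_card F {: code}).
apply/subset_leq_card/subsetP=> _ /imageP[G /asboolP XG ->].
have [j le_jk [H HL [f fP]]] := Xk _ G XG.
have [v vP] := choice (fun i => class_L_isolated (HL i)).
apply/imageP.
(* The [j] graphs are padded to [k] with complete graphs, and the truth table reads only the first
   [j] bits. *)
exists ([ffun i : 'I_k => if insub (val i) is Some i' then v i' else None],
        [ffun p : {ffun 'I_k -> bool} => f [ffun i => p (widen_ord le_jk i)]]).
  by [].
apply/ffunP=> -[a b]; rewrite !ffunE /=.
have [->|ab] := eqVneq a b; first exact: adj_irrefl.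
rewrite [LHS]fP //; congr f; apply/ffunP=> i; rewrite !ffunE /=.
case: insubP => [i' _ /val_inj <-|]; first by rewrite vP.
by rewrite ltn_ord.
Qed.

(** * Asymptotic estimates and the two implications *)

(** The logarithm [l] is at most [2 * q.+1], while [q.+1 ^ 2 <= 2 ^ l.-1 <= n]. If [2 * M <= q.+1]
    this suffices; otherwise [l <= 4 * M], whence the threshold [4 * M * M]. *)
Lemma up_log_sublinear (M : nat) :
  exists N, forall n, N <= n -> M * up_log 2 n.+1 <= n.
Proof.
exists (4 * M * M) => n leN.
have [l0|] := posnP (up_log 2 n.+1); first by rewrite l0 muln0.
move=> l_gt0; have n_gt0 : 1 < n.+1 by move: l_gt0; rewrite up_log_gt0.
have := up_log_gtn (isT : 1 < 2) n_gt0; rewrite ltnS.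
move: (up_log 2 n.+1) l_gt0 => l l_gt0 le_n.
pose q := l.-1./2.
have q2n : q.+1 * q.+1 <= n.
  apply: leq_trans le_n; apply: leq_trans (_ : 2 ^ q * 2 ^ q <= _).
    by rewrite leq_mul // ltn_expl.
  by rewrite -expnD leq_exp2l // addnn /q; lia.
have l_le : l <= q.+1 * 2 by rewrite /q; lia.
have [Mq|qM] := leqP (2 * M) q.+1.
  apply: leq_trans q2n; apply: leq_trans (_ : 2 * M * q.+1 <= _).
    by apply: leq_trans (leq_mul (leqnn M) l_le) _; lia.
  by rewrite leq_mul2r Mq orbT.
by apply: leq_trans leN; rewrite [M * l]mulnC leq_mul //; lia.
Qed.

(** An integer form of the little-o bound at [1/4]; this constant gives fewer than [2 ^ s] graphs
    whenever [n < s * 4], which covers both [n = s.+1] and [n = s * 2] for positive [s]. *)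
Lemma subexponential_pow4 (R : realType) (X : graph_family) :
  subexponential R X ->
  exists N, forall n, N <= n -> num_labelled X n ^ 4 <= 2 ^ n.
Proof.
case=> g /eqoP g_o gP.
have [N _ NP] := g_o (4^-1)%R ltac:(by rewrite invr_gt0).
exists N => n /NP /= le_g.
rewrite -(ler_nat R) !natrX.
apply: le_trans (_ : (2 `^ (4^-1 * n%:R)) ^+ 4 <= _)%R.
  apply: lerXn2r; rewrite ?nnegrE ?powR_ge0 //.
  apply: le_trans (gP n) _; apply: ler_powR; first lra.
  by apply: le_trans (ler_norm _) _; move: le_g; rewrite normr_nat.
rewrite -powR_mulrn ?powR_ge0 // -powRrM.
have -> : (4^-1 * n%:R * 4%:R = n%:R :> R)%R by lra.
by rewrite powR_mulrn.
Qed.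

Lemma function_subexponential (R : realType) (X : graph_family) :
  function_of X class_L -> subexponential R X.
Proof.
case=> k Xk; exists (fun n => (k * up_log 2 n.+1 + 2 ^ k)%:R%R); last first.
  move=> n; rewrite powR_mulrn // -natrX ler_nat.
  apply: leq_trans (num_labelled_function n Xk) _.
  rewrite expnD leq_mul2r mulnC expnM; apply/orP; right.
  by have := up_logP n.+1 (isT : 1 < 2); case: (k) => // k' ?; rewrite leq_exp2r.
apply/eqoP=> e e_gt0; pose M := Num.bound (e^-1)%R.
(* The factor 2 leaves half of [n] to each of the summands [k * l] and [2 ^ k], once multiplied by
   [M]. *)
have [N NP] := up_log_sublinear (2 * M * k).
exists (N + 2 * M * 2 ^ k) => // n /= leN.
have {NP} := NP n ltac:(lia).
rewrite !normr_nat; set l := up_log 2 n.+1 => leMl.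
have leM : M * (k * l + 2 ^ k) <= n by rewrite mulnDr mulnA; lia.
rewrite -ler_pdivrMl //; apply: le_trans (_ : (M * (k * l + 2 ^ k))%:R <= _)%R.
  rewrite natrM ler_wpM2r // ltW //.
  by apply: archi_boundP; rewrite invr_ge0 ltW.
by rewrite ler_nat.
Qed.

Lemma subexponential_function (R : realType) (X : graph_family) :
  graph_class X -> hereditary X -> subexponential R X ->
  function_of X class_L.
Proof.
move=> Xc Xh /subexponential_pow4[N NP].
have small n s : N <= n -> n < s * 4 -> num_labelled X n < 2 ^ s.
  move=> leNn lt_ns; rewrite -(@ltn_exp2r _ _ 4) // -expnM.
  by apply: leq_ltn_trans (NP n leNn) _; rewrite ltn_exp2l.
(* One value serves as both [m] and [s]; the successor keeps [s] positive, so that [s.+1] and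
   [s * 2] lie strictly below [s * 4]. *)
pose s := N.+1; exists (s * 3 + s * 3 * s) => V G XG.
have [S leS /twin_cover_function HP] :
    exists2 S : {set V}, #|S| <= s * 3 + s * 3 * s & twin_cover G S.
  by apply: exists_twin_cover XG => //; apply: small; rewrite /s; lia.
by exists #|S|.
Qed.

Theorem theorem4p11 (R : realType) (X : graph_family)
    (X_class : graph_class X) (X_hereditary : hereditary X) :
  subexponential R X <-> function_of X class_L.
Proof.
split; first exact: subexponential_function.
exact: function_subexponential.
Qed.
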